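(* Let $\mathcal A$ be a unital C$^*$-algebra. If $h\in\mathcal H$ and $\tilde g\in\mathcal U(\theta_H)$, then $$\Phi_H(\tilde g\cdot h)=\tilde g\,\Phi_H(h)\,\tilde g^{-1},$$ i.e., $\Phi_H$ is equivariant for the action of $\mathcal U(\theta_H)$. Therefore $$\Gamma(\tilde g\cdot h)=(U^*\tilde gU)\cdot\Gamma(h).$$
   Context: $G$ is the group of invertible elements of $\mathcal A$, $Im(h)=\frac1{2i}(h-h^* )$, $\mathcal H=\{h\in\mathcal A: Im(h)\text{ positive and invertible}\}$, $\mathcal D=\{z\in\mathcal A:\|z\|<1\}$. $M_2(\mathcal A)$ acts by left multiplication on column vectors in $\mathcal A^2$, and $Gl_2(\mathcal A)$ is its group of invertible elements. Put $$\rho_H=\left(\begin{array}{cc}0&-i\\ i&0\end{array}\right),\qquad \rho_D=\left(\begin{array}{cc}1&0\\ 0&-1\end{array}\right),\qquad U=\frac1{\sqrt2}\left(\begin{array}{cc}1&1\\ i&-i\end{array}\right),$$ so $U$ is unitary and $U\rho_DU^*=\rho_H$. The $\mathcal A$-valued forms on $\mathcal A^2$ are $\theta_H(\mathbf x,\mathbf y)=\frac1i(x_1^*y_2-x_2^*y_1)$ and $\theta_D(\mathbf x,\mathbf y)=x_1^*y_1-x_2^*y_2$, and $\mathcal U(\theta_H)$, $\mathcal U(\theta_D)$ are the groups of elements of $Gl_2(\mathcal A)$ preserving $\theta_H$, $\theta_D$ respectively; $\tilde g\in\mathcal U(\theta_H)$ iff $U^*\tilde gU\in\mathcal U(\theta_D)$.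 Let $\mathcal K_H=\{\mathbf x=(x_1,x_2)^T\in\mathcal A^2:\theta_H(\mathbf x,\mathbf x)=1,\ x_1\in G\}$. For $\mathbf x\in\mathcal K_H$ let $p_{\mathbf x}=\mathbf x\mathbf x^*\rho_H\in M_2(\mathcal A)$, where $\mathbf x^*=(x_1^*\ x_2^* )$; that is, $p_{\mathbf x}(\mathbf y)=\mathbf x\,\theta_H(\mathbf x,\mathbf y)$. The map $\Phi_H$ sends $h\in\mathcal H$ to $2p_{\mathbf x}-1$, where $\mathbf x\in\mathcal K_H$ is any element with $x_2x_1^{-1}=h$ (well defined). Its values lie in $\mathcal Q_{\rho_H}=\{\epsilon\in M_2(\mathcal A):\epsilon^2=1,\ \rho_H\epsilon\text{ positive and invertible}\}$. $\Gamma:\mathcal H\to\mathcal D$ is the diffeomorphism $\Gamma(h)=(1+ih)(1-ih)^{-1}$. The group $\mathcal U(\theta_H)$ acts on $\mathcal H$ and $\mathcal U(\theta_D)$ acts on $\mathcal D$, both by $\left(\begin{array}{cc}a_{11}&a_{12}\\ a_{21}&a_{22}\end{array}\right)\cdot w=(a_{21}+a_{22}w)(a_{11}+a_{12}w)^{-1}$. *)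

(* Defs.v *)
From HB Require Import structures.
From mathcomp Require Import all_boot all_order all_algebra.
From mathcomp Require Import complex.
From mathcomp Require Import all_classical all_reals.
Set Implicit Arguments.
Unset Strict Implicit.
Unset Printing Implicit Defensive.
Import Order.TTheory GRing.Theory Num.Theory ComplexField.Normc.
Local Open Scope classical_set_scope.
Local Open Scope ring_scope.

(* Hierarchy Builder admits no join of the library's normed modules with rings
   short of numDomainType, hence the explicit norm; normc is the modulus of a
   complex number as an element of R. *)
HB.mixin Record isCStarAlgebra (R : realType) A of GRing.UnitAlgebra R[i] A := {
  cnorm : A -> R ;
  star : A -> A ;
  cnorm_eq0 : forall x : A, cnorm x = 0 -> x = 0 ;
  cnormD_le : forall x y : A, cnorm (x + y) <= cnorm x + cnorm y ;
  cnormZ : forall (c : R[i]) (x : A), cnorm (c *: x) = normc c * cnorm x ;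
  cnormM_le : forall x y : A, cnorm (x * y) <= cnorm x * cnorm y ;
  cnorm_complete : forall u : nat -> A,
    (forall e : R, 0 < e -> exists N : nat, forall m n : nat,
       (N <= m)%N -> (N <= n)%N -> cnorm (u m - u n) < e) ->
    exists l : A, forall e : R, 0 < e -> exists N : nat, forall n : nat,
       (N <= n)%N -> cnorm (u n - l) < e ;
  starD : forall x y : A, star (x + y) = star x + star y ;
  starZ : forall (c : R[i]) (x : A), star (c *: x) = (c^* : R[i]) *: star x ;
  starM : forall x y : A, star (x * y) = star y * star x ;
  starK : forall x : A, star (star x) = x ;
  cnorm_starM : forall x : A, cnorm (star x * x) = cnorm x ^+ 2
}.

#[short(type="cstarAlgType")]
HB.structure Definition CStarAlgebra (R : realType) :=
  {A of GRing.UnitAlgebra R[i] A & isCStarAlgebra R A}.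

Section HalfSpaceAndDisk.
Context {R : realType} {A : cstarAlgType R}.
Implicit Types (a h w z : A).

Definition spectrum a : set R[i] := [set l | a - l%:A \isn't a GRing.unit].

Definition positive a : Prop :=
  star a = a /\ spectrum a `<=` [set l | 0 <= l].

Definition imag h : A := (2 * 'i)^-1 *: (h - star h).

Definition halfspace : set A :=
  [set h | positive (imag h) /\ imag h \is a GRing.unit].

Definition disk : set A := [set z | cnorm z < 1].

Definition Gamma h : A := (1 + 'i *: h) * (1 - 'i *: h)^-1.

End HalfSpaceAndDisk.

Section Matrices.
Context {R : realType} {A : cstarAlgType R}.
Implicit Types (g : 'M[A]_2) (x y : 'cV[A]_2) (h w : A).

Definition mx22 (T : Type) (a b c d : T) : 'M[T]_2 :=
  \matrix_(i, j) if i == 0 then (if j == 0 then a else b)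
                 else (if j == 0 then c else d).

Definition adjmx (m n : nat) (M : 'M[A]_(m, n)) : 'M[A]_(n, m) :=
  (map_mx star M)^T.

(* The matrix ring over a noncommutative A carries no unitRingType structure,
   so GL_2(A) and its inverse are defined directly. *)
Definition is_inverse g g' : Prop := g *m g' = 1%:M /\ g' *m g = 1%:M.

Definition GL2 : set 'M[A]_2 := [set g | exists g', is_inverse g g'].

Definition inv2 g : 'M[A]_2 := xget 0 [set g' | is_inverse g g'].

Definition rhoH : 'M[A]_2 := mx22 0 (- 'i)%:A 'i%:A 0.

Definition U : 'M[A]_2 :=
  ((sqrtC 2)^-1 : R[i])%:A *: mx22 1 1 'i%:A (- 'i)%:A.

Definition thetaH x y : A :=
  'i^-1 *: (star (x 0 0) * y 1 0 - star (x 1 0) * y 0 0).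

Definition thetaD x y : A :=
  star (x 0 0) * y 0 0 - star (x 1 0) * y 1 0.

Definition preserving (theta : 'cV[A]_2 -> 'cV[A]_2 -> A) : set 'M[A]_2 :=
  [set g | GL2 g /\ forall x y, theta (g *m x) (g *m y) = theta x y].

(* The action of g on w is meaningful only when the denominator is a unit;
   x^-1 is x itself when x is not a unit. *)
Definition moebius_den g w : A := g 0 0 + g 0 1 * w.

Definition moebius g w : A := (g 1 0 + g 1 1 * w) * (moebius_den g w)^-1.

Definition KH : set 'cV[A]_2 :=
  [set x | thetaH x x = 1 /\ x 0 0 \is a GRing.unit].

Definition proj_of x : 'M[A]_2 := x *m adjmx x *m rhoH.

(* The value does not depend on the choice of x; it is the junk value
   - 1 when no such x exists, that is, when h is outside the half-space. *)
Definition PhiH h : 'M[A]_2 :=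
  let x := xget 0 [set x | KH x /\ x 1 0 * (x 0 0)^-1 = h] in
  proj_of x *+ 2 - 1%:M.

End Matrices.

(* Main.v *)
(** Call a self-adjoint [a] npos when [|t - a| <= t] for some [t >= 0]; this is
    additive, and Neumann series make [u + a] invertible for [u > 0]. If [a] is
    self-adjoint and [t + a] is invertible for all [t >= 0], then [a] has a
    self-adjoint square root: this holds for large [t + a], and descends to [t = 0]
    by small multiplicative corrections [1 - x] whose roots come from a fixed point.
    With Arens' inequality [|x^2| <= |x^2 + y^2|] for commuting self-adjoint [x], [y],
    npos is then equivalent to nonnegative spectrum. That [b^* b] is positive follows
    by doubling [b], starting from small [b].

    For the theorem, let [y = g (1, h)^T]. Since [g] preserves [thetaH],
    [y1^* y2 - y2^* y1 = h - h^*]; an element with positive invertible real part is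
    invertible, so [y1] is left invertible, and right invertibility comes from
    [y1 c^-1 = q1 + i q2] with [q1 q2^*] self-adjoint and [(q1, q2)] unimodular, where
    [c^2 = Im h]. Then [PhiH] depends only on [h] because two elements of [KH] over
    the same point differ by a unitary, and [g] maps the elements over [h] to elements
    over [g . h], while [g^-1 = rhoH g^* rhoH]. The second identity is the computation
    [U (1, Gamma h)^T = sqrt 2 (1, h)^T (1 - i h)^-1]. *)

From Stdlib Require Ncring Ncring_tac.
Require Import Defs.
From mathcomp Require Import all_boot all_order all_algebra complex.
From mathcomp Require Import all_classical all_reals.
From mathcomp Require Import ring lra.
Import Order.TTheory GRing.Theory Num.Theory.
Local Open Scope classical_set_scope.
Local Open Scope ring_scope.

(** * Normalization of noncommutative ring identities *)

Section NC.
Variable A : pzRingType.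
#[local] Instance nc_ops : @Ncring.Ring_ops A 0 1 (@GRing.add A) (@GRing.mul A)
  (fun x y => x - y) (@GRing.opp A) eq.
Proof. Defined.
#[local] Instance nc_ring : Ncring.Ring (Ro:=nc_ops).
Proof.
split; first exact: RelationClasses.eq_equivalence.
- by move=> x _ <- y _ <-.
- by move=> x _ <- y _ <-.
- by move=> x _ <- y _ <-.
- by move=> x _ <-.
- exact: (@add0r A).
- exact: (@addrC A).
- exact: (@addrA A).
- exact: (@mul1r A).
- exact: (@mulr1 A).
- exact: (@mulrA A).
- exact: (@mulrDl A).
- by move=> x y z; exact: (@mulrDr A).
- by [].
- exact: (@subrr A).
Qed.
End NC.
#[local] Existing Instance nc_ops.
#[local] Existing Instance nc_ring.
Ltac ncring := Ncring_tac.non_commutative_ring.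
Ltac ncring_nat := rewrite ?mulrS ?mulr0n; ncring.

Lemma geometric_small (R : realType) (M r e : R) : 0 <= r -> r < 1 -> 0 < e ->
  exists N, M * r ^+ N < e.
Proof.
move=> r0 r1 e0.
(* A Bernoulli inequality: [r ^+ n] is bounded by a multiple of 1 / n, so [N] comes from the
   archimedean property. *)
have bern n : n%:R * (1 - r) * r ^+ n <= 1 - r ^+ n.
  elim: n => [|n IH]; first by rewrite mul0r expr0 mul0r subrr.
  have := exprn_ge0 n r0; have : r ^+ n <= 1 by apply: exprn_ile1 => //; exact: ltW.
  move: IH; rewrite exprS -natr1; set s := r ^+ n; set m : R := n%:R => IH s1 s0.
  have := mulr_ge0 r0 (ltac:(lra) : 0 <= 1 - s - m * (1 - r) * s).
  have : 0 <= (1 - r) * (1 - r * s) by apply: mulr_ge0; nra.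
  nra.
have d0 : 0 < (1 - r) * e by rewrite mulr_gt0// subr_gt0.
pose N := Num.truncn (`|M| / ((1 - r) * e)).
exists N.+1; have : `|M| < N.+1%:R * ((1 - r) * e).
  by rewrite -ltr_pdivrMr// truncnS_gt.
have := bern N.+1; have := exprn_ge0 N.+1 r0.
set s := r ^+ _; set m : R := _%:R => s0 h1 h2.
have hM : M * s <= `|M| * s by apply: ler_wpM2r => //; exact: ler_norm.
case: (eqVneq s 0) => [->|sn0]; first by rewrite mulr0.
have sp : 0 < s by rewrite lt_def sn0.
have : `|M| * s < m * ((1 - r) * e) * s by rewrite ltr_pM2r.
have : e * (m * (1 - r) * s) <= e * (1 - s) by rewrite ler_pM2l.
have : 0 <= e * s by rewrite mulr_ge0// ltW.
lra.
Qed.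

(** * Norm, involution and real scalars *)

Section Norm.
Context {R : realType} {A : cstarAlgType R}.
Implicit Types (x y z a b c d : A) (r s t u : R).

Definition scal r : A := (r%:C%C)%:A.
Local Notation "r %:S" := (scal r) (at level 1, left associativity, format "r %:S").

Lemma scal0 : 0%:S = 0. Proof. by rewrite /scal rmorph0 scale0r. Qed.
Lemma scal1 : 1%:S = 1. Proof. by rewrite /scal rmorph1 scale1r. Qed.
Lemma scalD r s : (r + s)%:S = r%:S + s%:S.
Proof. by rewrite /scal rmorphD scalerDl. Qed.
Lemma scalN r : (- r)%:S = - r%:S.
Proof. by rewrite /scal rmorphN scaleNr. Qed.
Lemma scalB r s : (r - s)%:S = r%:S - s%:S.
Proof. by rewrite scalD scalN. Qed.
Lemma scalM r s : (r * s)%:S = r%:S * s%:S.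
Proof. by rewrite /scal rmorphM mulr_algl scalerA. Qed.
Lemma scalC r x : r%:S * x = x * r%:S.
Proof. by rewrite /scal mulr_algl mulr_algr. Qed.
Lemma scal_natr n : (n%:R : R)%:S = n%:R.
Proof. by rewrite /scal !rmorph_nat scaler_nat. Qed.

Lemma normc_real r : ComplexField.Normc.normc r%:C%C = `|r|.
Proof. by rewrite /ComplexField.Normc.normc /= expr0n addr0 sqrtr_sqr. Qed.

Lemma cnorm0 : cnorm (0 : A) = 0.
Proof.
by rewrite -(scale0r (1:A)) cnormZ ComplexField.Normc.normc0 mul0r.
Qed.

Lemma cnorm_scalM r x : cnorm (r%:S * x) = `|r| * cnorm x.
Proof. by rewrite /scal mulr_algl cnormZ normc_real. Qed.

Lemma cnormN x : cnorm (- x) = cnorm x.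
Proof. by rewrite -mulN1r -scal1 -scalN cnorm_scalM normrN1 mul1r. Qed.

Lemma cnorm_ge0 x : 0 <= cnorm x.
Proof. by have := cnormD_le x (- x); rewrite subrr cnorm0 cnormN; lra. Qed.

Lemma cnormB_le x y : cnorm (x - y) <= cnorm x + cnorm y.
Proof. by rewrite -(cnormN y) cnormD_le. Qed.

Lemma cnormBC x y : cnorm (x - y) = cnorm (y - x).
Proof. by rewrite -cnormN opprB. Qed.

(** The C*-identity gives |1| = |1|^2, and |1| = 0 is excluded because [1] is not [0]. *)
Lemma cnorm_unit : cnorm (1 : A) = 1.
Proof.
have star1 : star (1 : A) = 1.
  by rewrite -[LHS]mulr1 -{2}[1]starK -starM mulr1 starK.
have := cnorm_starM (1 : A); rewrite star1 mul1r expr2 => h.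
have /eqP : cnorm (1 : A) * (cnorm (1 : A) - 1) = 0 by rewrite mulrBr mulr1 -h subrr.
rewrite mulf_eq0 => /orP[/eqP/cnorm_eq0/eqP|/eqP]; last lra.
by rewrite oner_eq0.
Qed.

Lemma cnorm_scal r : cnorm r%:S = `|r|.
Proof. by rewrite -[r%:S]mulr1 cnorm_scalM cnorm_unit mulr1. Qed.

Lemma star0 : star (0 : A) = 0.
Proof. by apply: (addrI (star 0)); rewrite -starD !addr0. Qed.
Lemma starN x : star (- x) = - star x.
Proof. by apply: (addrI (star x)); rewrite -starD !subrr star0. Qed.
Lemma starB x y : star (x - y) = star x - star y.
Proof. by rewrite starD starN. Qed.
Lemma star1 : star (1 : A) = 1.
Proof. by rewrite -[LHS]mulr1 -{2}[1]starK -starM mulr1 starK. Qed.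
Lemma star_scal r : star r%:S = r%:S.
Proof. by rewrite /scal starZ star1 conj_Creal // complex_real. Qed.

Definition imI : A := 'i%:A.
Local Notation I := imI.
Lemma imI_sqr : I * I = -1.
Proof. by rewrite /I mulr_algl scalerA -expr2 sqrCi scaleN1r. Qed.
Lemma imIC x : I * x = x * I.
Proof. by rewrite /I mulr_algl mulr_algr. Qed.
Lemma star_imI : star I = - I.
Proof. by rewrite /I starZ star1 conjCi scaleNr. Qed.
Lemma scale_imI x : 'i *: x = I * x.
Proof. by rewrite mulr_algl. Qed.

(** |y|^2 = |y^* y| <= |y^*| |y| gives one inequality, and its instance at [star x] the other. *)
Lemma cnorm_star x : cnorm (star x) = cnorm x.
Proof.
suff le y : cnorm y <= cnorm (star y).
  by apply/eqP; rewrite eq_le le andbT; have := le (star x); rewrite starK.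
have := cnorm_starM y; have := cnormM_le (star y) y.
have := cnorm_ge0 y; have := cnorm_ge0 (star y).
rewrite expr2 => h1; rewrite le_eqVlt => /orP[/eqP<- //|y0] h2 h3.
by rewrite -(ler_pM2r y0) -h3.
Qed.

Lemma cnorm_small x K : (forall e : R, 0 < e -> cnorm x <= K * e) -> x = 0.
Proof.
move=> h; apply: cnorm_eq0; apply/eqP; rewrite eq_le cnorm_ge0 andbT.
apply/ler_addgt0Pl => e e0; rewrite addr0.
have K1 : 0 < `|K| + 1 by rewrite ltr_wpDl.
apply: (le_trans (h _ (divr_gt0 e0 K1))).
rewrite mulrCA ler_piMr ?(ltW e0)//.
rewrite ler_pdivrMr// mul1r; have := ler_norm K; lra.
Qed.

Lemma star_unit x : x \is a GRing.unit -> star x \is a GRing.unit.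
Proof.
move=> xu; apply/unitrP; exists (star x^-1).
by rewrite -!starM mulrV// mulVr// star1.
Qed.

Lemma starV x : x \is a GRing.unit -> star x^-1 = (star x)^-1.
Proof.
move=> xu; apply: (mulIr (star_unit x xu)).
by rewrite -starM mulrV// star1 mulVr// star_unit.
Qed.

Lemma scal_unit r : r != 0 -> r%:S \is a GRing.unit.
Proof.
move=> r0; apply/unitrP; exists (r^-1)%:S.
by rewrite -!scalM mulVf// divff// scal1.
Qed.

Lemma unit_scalM r x : r != 0 -> (r%:S * x \is a GRing.unit) = (x \is a GRing.unit).
Proof. by move=> /scal_unit/unitrMr ->. Qed.

Lemma geometric_cauchy (u : nat -> A) (r M : R) : 0 <= r -> r < 1 -> 
  (forall n, cnorm (u n.+1 - u n) <= M * r ^+ n) ->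
  exists l, forall e : R, 0 < e -> exists N, forall n, (N <= n)%N -> cnorm (u n - l) < e.
Proof.
move=> r0 r1 hu.
have M0 : 0 <= M by have := hu 0; rewrite expr0 mulr1; apply: le_trans; exact: cnorm_ge0.
(* Telescoping against the partial sums of the geometric series. *)
have hd n k : cnorm (u (n + k)%N - u n) <= M / (1 - r) * (r ^+ n - r ^+ (n + k)).
  elim: k => [|k IH]; first by rewrite addn0 !subrr cnorm0 mulr0.
  have -> : u (n + k.+1)%N - u n = (u (n + k).+1 - u (n + k)%N) + (u (n + k)%N - u n).
    by rewrite addrA subrK addnS.
  apply: (le_trans (cnormD_le _ _)); apply: (le_trans (lerD (hu _) IH)).
  rewrite addnS exprS.
  rewrite le_eqVlt; apply/orP; left; apply/eqP; field.
  by rewrite subr_eq0 gt_eqF.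
have hs n k : cnorm (u (n + k)%N - u n) <= M / (1 - r) * r ^+ n.
  apply: (le_trans (hd n k)); apply: ler_wpM2l.
    by rewrite divr_ge0// subr_ge0 ltW.
  by rewrite gerBl exprn_ge0.
apply: cnorm_complete => e e0.
have K0 : 0 < M / (1 - r) + 1 by rewrite ltr_wpDl// divr_ge0// subr_ge0 ltW.
have [N hN] := geometric_small _ (M / (1 - r)) _ _ r0 r1 (divr_gt0 e0 (ltr0n _ 2)).
exists N => m n Nm Nn.
have -> : u m - u n = (u m - u N) - (u n - u N) by rewrite opprB addrA subrK.
apply: (le_lt_trans (cnormB_le _ _)).
rewrite -(subnKC Nm) -(subnKC Nn).
have := hs N (m - N)%N; have := hs N (n - N)%N; lra.
Qed.
End Norm.

(** * Fixed points, invertibility, and square roots near the identity *)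

Section Calculus.
Context {R : realType} {A : cstarAlgType R}.
Implicit Types (x y z a b c d : A) (r s t u : R).
Local Notation "r %:S" := (scal r) (at level 1, left associativity, format "r %:S").
Local Notation I := imI.

Definition limit_point (D : A -> Prop) l :=
  forall e : R, 0 < e -> exists y, D y /\ cnorm (y - l) < e.

(** Banach iteration from [0]. The invariant closed set [D] lets the fixed point inherit
    commutation, self-adjointness and norm bounds from the iterates. *)
Lemma contraction_fixpoint (F : A -> A) (D : A -> Prop) r :
  0 <= r -> r < 1 -> D 0 -> (forall x, D x -> D (F x)) ->
  (forall x y, D x -> D y -> cnorm (F x - F y) <= r * cnorm (x - y)) ->
  (forall l, limit_point D l -> D l) -> exists l, D l /\ F l = l.
Proof.
move=> r0 r1 D0 DF hF Dl.
pose u n := iter n F 0.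
have Du n : D (u n) by elim: n => //= n; exact: DF.
have [l hl] : exists l, forall e : R, 0 < e ->
    exists N, forall n, (N <= n)%N -> cnorm (u n - l) < e.
  apply: (geometric_cauchy _ _ (cnorm (u 1 - u 0)) r0 r1).
  elim=> [|n IH]; first by rewrite expr0 mulr1.
  rewrite exprS mulrCA; apply: (le_trans (hF _ _ (Du n.+1) (Du n))).
  exact: ler_wpM2l.
have Dl' : D l.
  by apply: Dl => e e0; have [N hN] := hl e e0; exists (u N); split => //; apply: hN.
exists l; split => //; apply/eqP; rewrite -subr_eq0; apply/eqP.
apply: (cnorm_small _ 2) => e e0; have [N hN] := hl e e0.
have -> : F l - l = (F l - F (u N)) + (u N.+1 - l) by rewrite addrA subrK.
apply: (le_trans (cnormD_le _ _)).
have := hF _ _ Dl' (Du N); rewrite cnormBC.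
rewrite [cnorm (l - _)]cnormBC.
have := hN N (leqnn _); have := hN N.+1 (leqnSn _); have := cnorm_ge0 (u N - l).
rewrite [cnorm (F _ - _)]cnormBC; nra.
Qed.

Lemma limit_point_bounded_linear (G : A -> A) (K : R) (D : A -> Prop) l :
  (forall x y, G (x - y) = G x - G y) -> (forall x, cnorm (G x) <= K * cnorm x) ->
  (forall y, D y -> G y = 0) -> limit_point D l -> G l = 0.
Proof.
move=> GB GK GD hl; apply: (cnorm_small _ `|K|) => e e0.
have [y [Dy hy]] := hl e e0.
rewrite -cnormN -[- G l]add0r -(GD y Dy) -GB.
apply: (le_trans (GK _)); apply: (@le_trans _ _ (`|K| * cnorm (y - l))).
  by apply: ler_wpM2r; [exact: cnorm_ge0|exact: ler_norm].
by apply: ler_wpM2l => //; exact: ltW.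
Qed.

Lemma limit_point_comm z (D : A -> Prop) l :
  (forall y, D y -> z * y = y * z) -> limit_point D l -> z * l = l * z.
Proof.
move=> hD hl; apply/eqP; rewrite -subr_eq0; apply/eqP.
pose G y := z * y - y * z.
apply: (limit_point_bounded_linear G (2 * cnorm z) D) => //.
- by move=> x y; rewrite /G; ncring.
- move=> x; apply: (le_trans (cnormB_le _ _)).
  by have := cnormM_le z x; have := cnormM_le x z; lra.
- by move=> y /hD; rewrite /G => ->; rewrite subrr.
Qed.

Lemma limit_point_star (D : A -> Prop) l :
  (forall y, D y -> star y = y) -> limit_point D l -> star l = l.
Proof.
move=> hD hl; apply/eqP; rewrite -subr_eq0; apply/eqP.
pose G y := star y - y.
apply: (limit_point_bounded_linear G 2 D) => //.
- by move=> x y; rewrite /G starB; ncring.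
- move=> x; apply: (le_trans (cnormB_le _ _)).
  by rewrite cnorm_star; lra.
- by move=> y /hD; rewrite /G => ->; rewrite subrr.
Qed.

Lemma limit_point_cnorm (D : A -> Prop) l (K : R) :
  (forall y, D y -> cnorm y <= K) -> limit_point D l -> cnorm l <= K.
Proof.
move=> hD hl; apply/ler_addgt0Pr => e e0; have [y [Dy hy]] := hl e e0.
have := hD y Dy; have := cnormB_le y (y - l).
by rewrite opprB addrCA subrr addr0; lra.
Qed.

(** The Neumann series is the fixed point of [1 + x * y]; keeping the iterates in the commutant of
    [x] makes this right inverse two-sided. *)
Lemma unit_1B x : cnorm x < 1 -> 1 - x \is a GRing.unit.
Proof.
move=> x1.
have [||||l [lx hl]] := contraction_fixpoint (fun y => 1 + x * y)
   (fun y => x * y = y * x) (cnorm x) (cnorm_ge0 x) x1.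
- by rewrite mulr0 mul0r.
- by move=> y h; rewrite mulrDl mulrDr mulr1 mul1r -mulrA -h.
- by move=> y z _ _; rewrite opprD addrACA subrr add0r -mulrBr; exact: cnormM_le.
- by move=> l; exact: limit_point_comm.
have h1 : (1 - x) * l = 1 by rewrite mulrBl mul1r -{1}hl addrK.
apply/unitrP; exists l; split => //.
by rewrite mulrBr mulr1 -lx -{1}hl addrK.
Qed.

Lemma unit_scalD t x : cnorm x < t -> t%:S + x \is a GRing.unit.
Proof.
move=> xt; have t0 : 0 < t by exact: le_lt_trans (cnorm_ge0 x) xt.
have -> : t%:S + x = t%:S * (1 - (- t^-1)%:S * x).
  by rewrite mulrBr mulr1 mulrA -scalM mulrN divff ?gt_eqF// scalN scal1 mulN1r opprK.
rewrite unit_scalM ?gt_eqF//; apply: unit_1B.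
by rewrite cnorm_scalM normrN gtr0_norm ?invr_gt0// mulrC ltr_pdivrMr// mul1r.
Qed.

(** Membership of [c] in the bicommutant of [a]. It stands in for being a function of [a], and makes
    successive roots commute. *)
Definition bicommutes a c := forall z, z * a = a * z -> z * c = c * z.

(** The root is 1 - y with y = (x + y^2) / 2. On the ball of radius 1/2 this map contracts by 1/2,
    and the bound 3/4 keeps the ball invariant: (3/4 + 1/4) / 2 = 1/2. *)
Lemma sqrt_1B x : star x = x -> cnorm x <= 3 / 4 ->
  exists d, [/\ star d = d, d * d = 1 - x & bicommutes x d].
Proof.
move=> xs x34.
pose h : A := (2^-1 : R)%:S.
have hh : h + h = 1 by rewrite /h -scalD -[RHS]scal1; congr scal; lra.
pose D y := [/\ star y = y, cnorm y <= 1 / 2 & bicommutes x y].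
have hC z : h * z = z * h by exact: scalC.
have hn z : cnorm (h * z) = 1 / 2 * cnorm z.
  by rewrite cnorm_scalM ger0_norm; lra.
have D0 : D 0 by split; rewrite ?star0 ?cnorm0 //; [lra|move=> z _; rewrite mul0r mulr0].
have DF y : D y -> D (h * (x + y * y)).
  move=> [y1 y2 y3]; split.
  - by rewrite starM starD starM y1 xs star_scal hC.
  - rewrite hn; have := cnormD_le x (y * y); have := cnormM_le y y.
    have := cnorm_ge0 y; nra.
  - move=> z zx; rewrite mulrA -hC -!mulrA; congr (_ * _).
    by rewrite mulrDl mulrDr zx mulrA (y3 z zx) -mulrA (y3 z zx) mulrA.
have [|||l hl|y [[y1 _ y3] y4]] :=
    contraction_fixpoint (fun y => h * (x + y * y)) D (1 / 2) _ _ D0 DF.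
- by lra.
- by lra.
- move=> y z [_ y2 _] [_ z2 _]; rewrite -mulrBr hn.
  have -> : x + y * y - (x + z * z) = y * (y - z) + (y - z) * z by ncring.
  have := cnormD_le (y * (y - z)) ((y - z) * z).
  have := cnormM_le y (y - z); have := cnormM_le (y - z) z.
  have := cnorm_ge0 (y - z); nra.
- split.
  + by apply: limit_point_star hl => y [].
  + by apply: limit_point_cnorm hl => y [].
  + by move=> z zx; apply: limit_point_comm hl => y [_ _]; exact.
exists (1 - y); split; first by rewrite starB star1 y1.
  have : y + y = x + y * y.
    by rewrite -{1 2}y4 -mulrDl hh mul1r.
  move=> e; have -> : (1 - y) * (1 - y) = 1 - (y + y) + y * y by ncring.
  by rewrite e; ncring.
by move=> z zx; rewrite mulrBl mulrBr (y3 z zx) mulr1 mul1r.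
Qed.

(* For large [n], [|b - i n| < n + 1], so [b + i = (b - i n) + i (n + 1)] is invertible. *)
Lemma unit_D_imI b : star b = b -> b + I \is a GRing.unit.
Proof.
move=> bs; pose n := cnorm b ^+ 2.
have n0 : 0 <= n by exact: sqr_ge0.
have -> : b + I = I * ((n + 1)%:S + (- (I * b) - n%:S)).
  rewrite scalD scal1.
  have -> : I * (n%:S + 1 + (- (I * b) - n%:S)) = I - I * I * b by ncring.
  by rewrite imI_sqr mulN1r opprK addrC.
rewrite unitrMl.
  by apply/unitrP; exists (- I); rewrite mulNr mulrN imI_sqr opprK.
apply: unit_scalD.
suff : cnorm (- (I * b) - n%:S) ^+ 2 < (n + 1) ^+ 2.
  by rewrite ltr_pXn2r// nnegrE ?cnorm_ge0// addr_ge0.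
rewrite -cnorm_starM starB starN starM star_imI bs star_scal.
have -> : (- (b * - I) - n%:S) * (- (I * b) - n%:S) 
    = - (b * (I * I) * b) + (I * b - b * I) * n%:S 
     + (n * n)%:S.
  rewrite scalM; transitivity (- (b * (I * I) * b) + n%:S * (I * b) - b * I * n%:S + n%:S * n%:S); first ncring.
  by rewrite scalC; ncring.
rewrite imI_sqr imIC subrr mul0r addr0 mulrN1 mulNr opprK.
apply: (le_lt_trans (cnormD_le _ _)).
rewrite cnorm_scal (ger0_norm (mulr_ge0 n0 n0)).
have := cnorm_ge0 b; have := cnormM_le b b; rewrite -[cnorm b * _]expr2 -/n => h1 b0; nra.
Qed.

Lemma unit_D_scal_imI b t : star b = b -> t != 0 -> b + t%:S * I \is a GRing.unit.
Proof.
move=> bs t0; have -> : b + t%:S * I = t%:S * ((t^-1)%:S * b + I).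
  by rewrite mulrDr mulrA -scalM divff// scal1 mul1r.
by rewrite unit_scalM// unit_D_imI// starM star_scal bs scalC.
Qed.

End Calculus.

(** * Square roots of self-adjoint elements, and positivity read off the norm *)

Section Positive.
Context {R : realType} {A : cstarAlgType R}.
Implicit Types (x y z a b c d : A) (r s t u : R).
Local Notation "r %:S" := (scal r) (at level 1, left associativity, format "r %:S").
Local Notation I := imI.

Let sqrt_at a t := exists c, [/\ star c = c, c * c = t%:S + a & bicommutes a c].

Lemma sqrt_at_large a t : star a = a -> 0 < t -> cnorm a <= 3 / 4 * t -> sqrt_at a t.
Proof.
move=> sa t0 at34.
have [||d [sd dd dC]] := @sqrt_1B _ _ ((- t^-1)%:S * a).
- by rewrite starM sa star_scal scalC.
- by rewrite cnorm_scalM normrN gtr0_norm ?invr_gt0// mulrC ler_pdivrMr.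
exists ((Num.sqrt t)%:S * d); split.
- by rewrite starM star_scal sd scalC.
- rewrite mulrA -[_ * d * _]mulrA -[d * _]scalC !mulrA -scalM -expr2 sqr_sqrtr ?(ltW t0)//.
  rewrite -mulrA dd mulrBr mulr1 mulrA -scalM mulrN divff ?gt_eqF//.
  by rewrite scalN scal1 mulN1r opprK.
- move=> z za; have zd : z * d = d * z.
    by apply: dC; rewrite mulrA -scalC -!mulrA za.
  by rewrite mulrA -scalC -!mulrA zd.
Qed.

(** t - r + a = (t + a) (1 - r q) with q = (t + a)^-1. The roots of the two factors commute by the
    bicommutant condition, so their product is a root. *)
Lemma sqrt_at_step a t r : star a = a -> t%:S + a \is a GRing.unit ->
  sqrt_at a t -> `|r| * cnorm (t%:S + a)^-1 <= 3 / 4 -> sqrt_at a (t - r).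
Proof.
move=> sa tu [c [sc cc cC]] hr.
set q := (t%:S + a)^-1 in hr.
have sta : star (t%:S + a) = t%:S + a by rewrite starD star_scal sa.
have sq : star q = q by rewrite starV// sta.
have qC : bicommutes a q.
  by move=> z za; apply: commrV; rewrite /GRing.comm mulrDl mulrDr za scalC.
have [||d [sd dd dC]] := @sqrt_1B _ _ (r%:S * q).
- by rewrite starM sq star_scal scalC.
- by rewrite cnorm_scalM.
have dC' : bicommutes a d.
  by move=> z /qC zq; apply: dC; rewrite mulrA -scalC -!mulrA zq.
have cd : c * d = d * c by apply: dC'; apply/esym/cC.
exists (c * d); split.
- by rewrite starM sc sd cd.
- rewrite mulrA -[c * d * c]mulrA -cd mulrA cc -mulrA dd mulrBr mulr1.
  by rewrite mulrA -scalC -mulrA mulrV// mulr1 scalB; ncring.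
- by move=> z za; rewrite mulrA (cC z za) -mulrA (dC' z za) mulrA.
Qed.

(** [S] collects the shifts that admit a root. Near its infimum a downward step of uniform size
    either reaches 0 or falls below the infimum. *)
Lemma sqrt_exists a : star a = a ->
  (forall t, 0 <= t -> t%:S + a \is a GRing.unit) ->
  exists c, [/\ star c = c, c * c = a & bicommutes a c].
Proof.
move=> sa au.
suff [c] : sqrt_at a 0 by rewrite scal0 add0r; exists c.
pose S := [set t : R | 0 <= t /\ sqrt_at a t].
have na := cnorm_ge0 a.
have infS : has_inf S.
  split; last by exists 0 => t [].
  exists (2 * cnorm a + 1); split; first lra.
  by apply: sqrt_at_large => //; lra.
have S0 : 0 <= inf S by apply: lb_le_inf; [case: infS|move=> t []].
pose q0 := ((inf S)%:S + a)^-1.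
have nq0 := cnorm_ge0 q0.
(* The [+ 1] keeps the denominator positive. Steps will have length up to 2 m, from a [t] within m
   of [inf S]. *)
pose m := 1 / (8 * (cnorm q0 + 1)).
have m0 : 0 < m by apply: divr_gt0; lra.
have mq : m * cnorm q0 <= 1 / 8.
  rewrite /m mulrAC mul1r ler_pdivrMr; lra.
have [t [t0 Pt] tlt] := inf_adherent m0 infS.
have let0 : inf S <= t by apply: ge_inf => //; case: infS.
pose q := (t%:S + a)^-1.
have nq := cnorm_ge0 q.
(* By the resolvent identity and t - inf S < m, |q| <= |q0| + |q| / 8. *)
have qq0 : cnorm q <= 2 * cnorm q0.
  have : q = q0 - (t - inf S)%:S * (q0 * q).
    have e : (t - inf S)%:S = (t%:S + a) - ((inf S)%:S + a) by rewrite scalB; ncring.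
    rewrite mulrA scalC e mulrBr mulrBl -mulrA mulrV ?au// mulr1.
    by rewrite mulVr ?au// mul1r opprB addrCA subrr addr0.
  move=> h; have : cnorm q <= cnorm q0 + (t - inf S) * (cnorm q0 * cnorm q).
    rewrite {1}h; apply: (le_trans (cnormB_le _ _)); rewrite lerD2l cnorm_scalM.
    rewrite ger0_norm ?subr_ge0//; apply: ler_wpM2l; first by rewrite subr_ge0.
    exact: cnormM_le.
  have : (t - inf S) * (cnorm q0 * cnorm q) <= 1 / 8 * cnorm q.
    rewrite mulrA; apply: ler_wpM2r => //; apply: le_trans mq.
    by apply: ler_wpM2r => //; lra.
  lra.
have step r : 0 <= r -> r <= 2 * m -> sqrt_at a (t - r).
  move=> r0 rm; apply: sqrt_at_step => //; first exact: au.
  rewrite ger0_norm//; apply: (@le_trans _ _ (2 * m * (2 * cnorm q0))).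
    by apply: ler_pM.
  lra.
have [tm|tm] := leP t (2 * m).
  by have := step t t0 tm; rewrite subrr.
(* Since t < inf S + m, this element of [S] lies below [inf S]. *)
have : S (t - 2 * m) by split; [lra|apply: step; lra].
move=> /ge_inf => /(_ infS.2); lra.
Qed.

(* [x^2 + y^2 = (x + i y)^* (x + i y)], and [x] is the real part of [x + i y]. *)
Lemma cnorm_sqr_le x y : star x = x -> star y = y -> x * y = y * x ->
  cnorm (x * x) <= cnorm (x * x + y * y).
Proof.
move=> sx sy xy.
have e : star (x + I * y) * (x + I * y) = x * x + y * y.
  rewrite starD starM star_imI sx sy.
  transitivity (x * x + x * (I * y) - y * I * x - y * (I * I) * y); first ncring.
  rewrite imI_sqr mulrA -imIC -[y * I]imIC -mulrA xy mulrA addrK.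
  by rewrite mulrN1 mulNr opprK.
rewrite -e cnorm_starM.
have -> : cnorm (x * x) = cnorm x ^+ 2 by rewrite -{1}sx cnorm_starM.
rewrite ler_pXn2r ?nnegrE ?cnorm_ge0//.
set w := x + I * y.
have -> : x = 2^-1%:S * (w + star w).
  have -> : w + star w = 2%:S * x.
    rewrite /w starD starM star_imI sx sy scal_natr mulr_natl mulr2n.
    by rewrite mulrN -imIC addrACA subrr addr0.
  by rewrite mulrA -scalM mulVf ?scal1 ?mul1r// pnatr_eq0.
rewrite cnorm_scalM ger0_norm ?invr_ge0//.
by have := cnormD_le w (star w); rewrite cnorm_star; lra.
Qed.

(* A spectrum-free form of [positive] (they agree by [positive_npos]), chosen
   because it is visibly stable under sums. *)
Definition npos a := star a = a /\ exists2 t, 0 <= t & cnorm (t%:S - a) <= t.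

(** u + a = (u + t) - (t - a), where |t - a| <= t < u + t. *)
Lemma npos_unit a u : npos a -> 0 < u -> u%:S + a \is a GRing.unit.
Proof.
move=> [sa [t t0 at_]] u0.
have -> : u%:S + a = (u + t)%:S + (a - t%:S) by rewrite scalD; ncring.
by apply: unit_scalD; rewrite cnormBC; lra.
Qed.

Lemma nposD a b : npos a -> npos b -> npos (a + b).
Proof.
move=> [sa [t t0 ta]] [sb [s s0 sb']]; split; first by rewrite starD sa sb.
exists (t + s); first lra.
have -> : (t + s)%:S - (a + b) = (t%:S - a) + (s%:S - b) by rewrite scalD; ncring.
by have := cnormD_le (t%:S - a) (s%:S - b); lra.
Qed.

Lemma npos_scal u : 0 <= u -> npos u%:S.
Proof.
move=> u0; split; first exact: star_scal.
by exists u => //; rewrite subrr cnorm0.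
Qed.

Lemma npos_scalM u a : 0 <= u -> npos a -> npos (u%:S * a).
Proof.
move=> u0 [sa [t t0 ta]]; split; first by rewrite starM sa star_scal scalC.
exists (u * t); first exact: mulr_ge0.
by rewrite scalM -mulrBr cnorm_scalM ger0_norm// ler_wpM2l.
Qed.

(** t - c^2 has a root d commuting with c, and Arens' inequality gives |d^2| <= |d^2 + c^2| = t. *)
Lemma cnorm_scalB_sqr c t : star c = c -> cnorm (c * c) < t ->
  cnorm (t%:S - c * c) <= t.
Proof.
move=> sc ct; have t0 : 0 < t by apply: le_lt_trans ct; exact: cnorm_ge0.
have sb : star (t%:S - c * c) = t%:S - c * c by rewrite starB starM sc star_scal.
have [|d [sd dd dC]] := @sqrt_exists (t%:S - c * c) sb.
  move=> s s0; rewrite addrA -scalD; apply: unit_scalD; rewrite cnormN; lra.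
have cd : c * d = d * c.
  by apply: dC; rewrite mulrBr mulrBl scalC mulrA.
have := cnorm_sqr_le d c sd sc (esym cd).
by rewrite dd subrK cnorm_scal gtr0_norm.
Qed.

Lemma npos_sqr c : star c = c -> npos (c * c).
Proof.
move=> sc; split; first by rewrite starM sc.
exists (cnorm (c * c) + 1); first by rewrite addr_ge0 ?cnorm_ge0.
by apply: cnorm_scalB_sqr => //; lra.
Qed.

(** Converse of [npos_unit]: each u + a with u > 0 is the square of a self-adjoint element, and the
    bound of [cnorm_scalB_sqr] survives u -> 0. *)
Lemma npos_of_unit a : star a = a -> (forall u, 0 < u -> u%:S + a \is a GRing.unit) ->
  npos a.
Proof.
move=> sa au; split => //.
have na := cnorm_ge0 a.
exists (cnorm a + 1); first lra.
apply/ler_addgt0Pr => e e0.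
(* The bound 1/2 keeps |u + a| strictly below |a| + 1; the bound e / 2 controls the error of
   replacing [a] by u + a. *)
pose u := Num.min (e / 2) (1 / 2).
have u0 : 0 < u by rewrite lt_min; apply/andP; split; lra.
have ue : u <= e / 2 by rewrite ge_min lexx.
have u1 : u <= 1 / 2 by rewrite ge_min lexx orbT.
have [||c [sc cc _]] := @sqrt_exists (u%:S + a).
- by rewrite starD star_scal sa.
- by move=> t t0; rewrite addrA -scalD; apply: au; lra.
have : cnorm (c * c) < cnorm a + 1.
  rewrite cc; have := cnormD_le u%:S a; rewrite cnorm_scal gtr0_norm//; lra.
move=> /(cnorm_scalB_sqr _ _ sc); rewrite cc.
have -> : (cnorm a + 1)%:S - a = ((cnorm a + 1)%:S - (u%:S + a)) + u%:S by ncring.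
have := cnormD_le ((cnorm a + 1)%:S - (u%:S + a)) u%:S.
rewrite (cnorm_scal u) gtr0_norm//; lra.
Qed.

End Positive.

(** * Positivity of b^* b, spectra, and invertibility criteria *)

Section StarProducts.
Context {R : realType} {A : cstarAlgType R}.
Implicit Types (x y z a b c d e f h k m p q : A) (r s t u : R).
Local Notation "r %:S" := (scal r) (at level 1, left associativity, format "r %:S").
Local Notation I := imI.

Lemma imI_unit : (I : A) \is a GRing.unit.
Proof. by apply/unitrP; exists (- I); rewrite mulNr mulrN imI_sqr opprK. Qed.

(** The inverse is 1 - y (1 + x y)^-1 x. *)
Lemma unit_1D_mulC x y : 1 + x * y \is a GRing.unit -> 1 + y * x \is a GRing.unit.
Proof.
move=> xyu; pose w := (1 + x * y)^-1.
apply/unitrP; exists (1 - y * w * x); split.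
- have -> : (1 - y * w * x) * (1 + y * x) = 1 + y * x - y * (w * (1 + x * y)) * x by ncring.
  by rewrite mulVr// mulr1 addrK.
- have -> : (1 + y * x) * (1 - y * w * x) = 1 + y * x - y * ((1 + x * y) * w) * x by ncring.
  by rewrite mulrV// mulr1 addrK.
Qed.

(** Dividing by u + 1 turns u + 1 - f^* f into 1 + x y with x = f^* and y a multiple of f;
    [unit_1D_mulC] then exchanges the factors. *)
Lemma npos_1B_starC f : npos (1 - star f * f) -> npos (1 - f * star f).
Proof.
move=> hf; apply: npos_of_unit; first by rewrite starB starM star1 starK.
move=> u u0; have u1 : 0 < u + 1 by lra.
have e x : u%:S + (1 - x) = (u + 1)%:S * (1 + (- (u + 1)^-1)%:S * x).
  rewrite mulrDr mulr1 mulrA -scalM mulrN divff ?gt_eqF// scalN scal1 mulN1r.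
  by rewrite scalD scal1 addrA.
have := npos_unit _ _ hf u0; rewrite !e !unit_scalM ?gt_eqF//.
by rewrite [in X in _ -> X]mulrA [_ * (star f * f)]mulrA scalC -mulrA; apply: unit_1D_mulC.
Qed.

(* [f^* f + f f^* = (X^2 + Y^2) / 2] with [X], [Y] self-adjoint, while [f f^*] is
   bounded by [1] along with [f^* f]. *)
Lemma npos_1D_star f : npos (1 - star f * f) -> npos (1 + star f * f).
Proof.
move=> /npos_1B_starC hf.
pose X := f + star f; pose Y := I * (f - star f).
have sX : star X = X by rewrite starD starK addrC.
have sY : star Y = Y.
  by rewrite starM starB starK star_imI mulrN -imIC -mulrN opprB.
have YY : Y * Y = - ((f - star f) * (f - star f)).
  by rewrite /Y {1}imIC -!mulrA [I * (I * _)]mulrA imI_sqr mulN1r mulrN.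
have -> : 1 + star f * f = (1 - f * star f) + 2^-1%:S * (X * X + Y * Y).
  have -> : X * X + Y * Y = 2%:R * (star f * f + f * star f).
    by rewrite YY /X; ncring_nat.
  rewrite mulrA -scal_natr -scalM mulVf ?pnatr_eq0// scal1; ncring.
apply: nposD => //; apply: npos_scalM; first by rewrite invr_ge0.
by apply: nposD; exact: npos_sqr.
Qed.

(* With [q = (1 + b^* b)^-1] and [f = 2 b q], [1 - f^* f = (1 - 2 q)^2] is positive,
   so [7/9 + 1 + f^* f = 4/9 (4 - 3 q) (1 + 3 q)] is invertible, and
   [4 - 3 q = (1 + 4 b^* b) q]. *)
Lemma unit_1D_star_double b : 1 + star b * b \is a GRing.unit ->
  1 + star (b + b) * (b + b) \is a GRing.unit.
Proof.
set p := 1 + star b * b => pu; pose q := p^-1.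
have pq : p * q = 1 by rewrite mulrV.
have sp : star p = p by rewrite starD starM starK star1.
have sq : star q = q by rewrite starV// sp.
pose f := (b + b) * q.
have ff : star f * f = 4%:R * (q - q * q).
  have -> : q - q * q = q * (p * q) - q * (1 * q) by rewrite pq mulr1 mul1r.
  by rewrite starM sq starD /f /p; ncring_nat.
have : npos (1 + star f * f).
  apply: npos_1D_star.
  have -> : 1 - star f * f = (1 - (q + q)) * (1 - (q + q)) by rewrite ff; ncring_nat.
  by apply: npos_sqr; rewrite starB star1 starD sq.
have u0 : 0 < 7 / 9 :> R by lra.
move=> /npos_unit /(_ u0).
rewrite -(unit_scalM 9) ?pnatr_eq0// mulrDr -scalM mulrCA divff ?pnatr_eq0// mulr1.
rewrite !scal_natr ff.
have -> : 7%:R + 9%:R * (1 + 4%:R * (q - q * q)) = (4%:R - 3%:R * q) * (4%:R * (1 + 3%:R * q)).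
  by ncring_nat.
rewrite unitrM_comm; last by rewrite /GRing.comm; ncring_nat.
move=> /andP[h _].
have -> : 1 + star (b + b) * (b + b) = (4%:R - 3%:R * q) * p.
  rewrite mulrBl -[3%:R * q * p]mulrA mulVr// starD /p; ncring_nat.
by rewrite unitrMr.
Qed.

(** For large n, b / 2^n has norm below 1 and the Neumann series applies; n doublings lead back to
    b. *)
Lemma unit_1D_star b : 1 + star b * b \is a GRing.unit.
Proof.
have two n : (2 ^+ n : R) != 0 by rewrite expf_neq0// pnatr_eq0.
pose n := (Num.truncn (cnorm b)).+1.
have bn : cnorm b < 2 ^+ n.
  have := truncnS_gt (cnorm b); rewrite -/n => h; apply: (lt_trans h).
  by rewrite -natrX ltr_nat ltn_expl.
pose b0 := ((2 ^+ n)^-1)%:S * b.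
have -> : b = (2 ^+ n)%:S * b0 by rewrite /b0 mulrA -scalM divff// scal1 mul1r.
suff h (k : nat) : 1 + star ((2 ^+ k)%:S * b0) * ((2 ^+ k)%:S * b0) \is a GRing.unit by exact: h.
elim: k => [|j IH].
  rewrite expr0 scal1 mul1r -[1]scal1; apply: unit_scalD.
  rewrite cnorm_starM expr_lt1 ?cnorm_ge0// /b0 cnorm_scalM ger0_norm.
    by rewrite mulrC ltr_pdivrMr ?exprn_gt0// mul1r.
  by rewrite invr_ge0 exprn_ge0.
have -> : (2 ^+ j.+1)%:S * b0 = (2 ^+ j)%:S * b0 + (2 ^+ j)%:S * b0.
  by rewrite exprS mulr_natl mulr2n scalD mulrDl.
exact: unit_1D_star_double.
Qed.

Lemma star_scalM_mul r b : star (r%:S * b) * (r%:S * b) = (r * r)%:S * (star b * b).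
Proof.
rewrite starM star_scal scalM -(scalC r (star b)) -!mulrA; congr (_ * _).
by rewrite mulrA -scalC -mulrA.
Qed.

(** u + b^* b = u (1 + d^* d) with d = b / sqrt u. *)
Lemma npos_star b : npos (star b * b).
Proof.
apply: npos_of_unit; first by rewrite starM starK.
move=> u u0; have s0 : Num.sqrt u != 0 by rewrite gt_eqF// sqrtr_gt0.
have -> : u%:S + star b * b =
    u%:S * (1 + star ((Num.sqrt u)^-1%:S * b) * ((Num.sqrt u)^-1%:S * b)).
  rewrite star_scalM_mul mulrDr mulr1 mulrA -scalM -invfM -expr2 sqr_sqrtr ?ltW//.
  by rewrite divff ?gt_eqF// scal1 mul1r.
by rewrite unit_scalM ?gt_eqF// unit_1D_star.
Qed.

Lemma npos_starr b : npos (b * star b).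
Proof. by have := npos_star (star b); rewrite starK. Qed.

Lemma npos_unit_sqrt a : npos a -> a \is a GRing.unit ->
  exists c, [/\ star c = c, c * c = a & c \is a GRing.unit].
Proof.
move=> ha au; have [||c [sc cc _]] := @sqrt_exists _ _ a; first by case: ha.
- move=> t; rewrite le_eqVlt => /orP[/eqP<-|]; first by rewrite scal0 add0r.
  exact: npos_unit.
- exists c; split => //.
  by move: au; rewrite -cc -expr2 unitrX_pos.
Qed.

Lemma complex_scal (l : R[i]) : l%:A = (complex.Re l)%:S + (complex.Im l)%:S * I :> A.
Proof.
by rewrite {1}[l]complexE scalerDl complexiE -/(scal _) mulrC -scalerA -mulr_algl.
Qed.

Lemma positive_npos a : positive a <-> npos a.
Proof.
split=> [[sa ha]|ha].
  apply: npos_of_unit => // u u0; apply/negPn/negP => nu.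
  have /= := ha (- u)%:C%C; rewrite /spectrum /= -/(scal (- u)) scalN opprK addrC.
  by move=> /(_ nu); rewrite ler0c; lra.
have sa : star a = a by case: ha.
split=> // l; rewrite /spectrum /= complex_scal => /negP nu.
(* For nonreal [l], a - l is a self-adjoint element plus a nonzero imaginary scalar, hence
   invertible. *)
have im0 : complex.Im l = 0.
  apply/eqP/negPn/negP => im0; apply: nu.
  have -> : a - ((complex.Re l)%:S + (complex.Im l)%:S * I)
     = (a - (complex.Re l)%:S) + (- complex.Im l)%:S * I by rewrite scalN; ncring.
  by apply: unit_D_scal_imI; rewrite ?oppr_eq0// starB star_scal sa.
rewrite lecE /= im0 eqxx /= leNgt; apply/negP => re0; apply: nu.
rewrite im0 scal0 mul0r addr0 addrC -scalN; apply: npos_unit => //; lra.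
Qed.

(* If [c^2 = k] then [c^-1 m c^-1] is [1/2 + i b] with [b] self-adjoint. *)
Lemma accretive_unit m k : npos k -> k \is a GRing.unit -> m + star m = k ->
  m \is a GRing.unit.
Proof.
move=> kp ku mk; have [c [sc cc cu]] := npos_unit_sqrt _ kp ku.
have cVu : c^-1 \is a GRing.unit by rewrite unitrV.
have [n nE] : exists n, n = c^-1 * m * c^-1 by eexists.
have sn : star n = 1 - n.
  apply: (addrI n); rewrite addrCA subrr addr0.
  rewrite nE !starM starV// sc mulrA -mulrDl -mulrDr mk -cc !mulrA mulVr// mul1r.
  by rewrite mulrV.
pose b := I * n - 2^-1%:S * I.
have half : 2^-1%:S + 2^-1%:S = 1 :> A by rewrite -scalD -[RHS]scal1; congr scal; lra.
have sb : star b = b.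
  rewrite starB !starM star_imI star_scal sn /b.
  transitivity (- I + n * I + I * 2^-1%:S); first ncring.
  rewrite -[n * I]imIC -(scalC _ I) -[X in - X + _]mul1r -half; ncring.
have : b + 2^-1%:S * I \is a GRing.unit by apply: unit_D_scal_imI; rewrite ?invr_eq0 ?pnatr_eq0.
by rewrite subrK (unitrMr _ imI_unit) nE (unitrMl _ cVu) (unitrMr _ cVu).
Qed.

(* Expanding [(q - r p^* ) (q - r p^* )^* >= 0] gives [q q^* >= 2 r - r^2 p^* p]. *)
Lemma unimodular_unit (q1 q2 p1 p2 : A) : q1 * p1 + q2 * p2 = 1 ->
  q1 * star q1 + q2 * star q2 \is a GRing.unit.
Proof.
move=> qp.
have qp' : star p1 * star q1 + star p2 * star q2 = 1.
  by rewrite -!starM -starD qp star1.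
pose P := star p1 * p1 + star p2 * p2.
have nP := cnorm_ge0 P.
(* This choice gives |r P| <= 1, so 1 - r P is [npos] with bound 1. *)
pose r := (cnorm P + 1)^-1.
have r0 : 0 < r by rewrite invr_gt0; lra.
pose v1 := q1 - r%:S * star p1; pose v2 := q2 - r%:S * star p2.
have sv p q : star (q - r%:S * star p) = star q - r%:S * p.
  by rewrite starB starM star_scal starK scalC.
have -> : q1 * star q1 + q2 * star q2 =
   r%:S + ((v1 * star v1 + v2 * star v2) + r%:S * (1 - r%:S * P)).
  rewrite /v1 /v2 !sv.
  have e p q : (q - r%:S * star p) * (star q - r%:S * p) = q * star q
     - r%:S * (q * p + star p * star q) + r%:S * (r%:S * (star p * p)).
    transitivity (q * star q - q * r%:S * p - r%:S * star p * star q
       + r%:S * (star p * r%:S) * p); first ncring.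
    by rewrite -[q * r%:S]scalC -[star p * r%:S]scalC; ncring.
  rewrite !e.
  transitivity (q1 * star q1 + q2 * star q2 + r%:S * (1 + 1 -
     (q1 * p1 + q2 * p2) - (star p1 * star q1 + star p2 * star q2))).
    by rewrite qp qp'; ncring.
  by rewrite /P; ncring.
apply: npos_unit => //; apply: nposD; first by apply: nposD; exact: npos_starr.
apply: npos_scalM; first exact: ltW.
split; first by rewrite starB starM star_scal star1 starD !starM !starK scalC.
exists 1 => //; rewrite scal1 opprB addrCA subrr addr0 cnorm_scalM gtr0_norm//.
by rewrite mulrC ler_pdivrMr; lra.
Qed.

(** u + a and u + s - a have commuting roots g and c, and Arens' inequality bounds |g^2| by |g^2 +
    c^2| = s + 2 u. Passing back to [a] costs a third u, whence e / 3. *)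
Lemma npos_cnorm_le a s : npos a -> npos (s%:S - a) -> cnorm a <= s.
Proof.
move=> ha hs; apply/ler_addgt0Pr => e e0; pose u := e / 3.
have u0 : 0 < u by rewrite /u; lra.
have sqrtD b : npos b -> exists c, [/\ star c = c, c * c = u%:S + b & bicommutes (u%:S + b) c].
  move=> hb; apply: sqrt_exists; first by rewrite starD star_scal hb.1.
  by move=> t t0; rewrite addrA -scalD; apply: npos_unit => //; lra.
have [g [sg gg gC]] := sqrtD _ ha; have [c [sc cc cC]] := sqrtD _ hs.
have gc : g * c = c * g.
  apply/cC/esym; have -> : u%:S + (s%:S - a) = (u + u + s)%:S - g * g.
    by rewrite gg !scalD; ncring.
  by rewrite mulrBl mulrBr scalC mulrA.
have := cnorm_sqr_le g c sg sc gc; rewrite gg cc.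
have -> : u%:S + a + (u%:S + (s%:S - a)) = (u + u + s)%:S by rewrite !scalD; ncring.
have := cnormB_le (u%:S + a) u%:S; rewrite addrAC subrr add0r !cnorm_scal (gtr0_norm u0).
(* The sum of a and s - a is the scalar s, and |t - s| <= t forces s >= 0. *)
have : 0 <= s.
  have [_ [t t0]] := nposD _ _ ha hs.
  by rewrite addrCA subrr addr0 -scalB cnorm_scal; have := ler_norm (t - s); lra.
rewrite /u; move=> s0; rewrite ger0_norm; lra.
Qed.

(** For u <= e, a - (e - u) = (1 - (e - u) a^-1) a is invertible by the Neumann series, as e |a^-1|
    < 1. *)
Lemma npos_unit_scalB a : npos a -> a \is a GRing.unit ->
  exists2 e : R, 0 < e & npos (a - e%:S).
Proof.
move=> ha au; have na := cnorm_ge0 a^-1.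
pose e := (cnorm a^-1 + 1)^-1.
have e0 : 0 < e by rewrite invr_gt0; lra.
exists e => //; apply: npos_of_unit; first by rewrite starB star_scal ha.1.
move=> u u0; have -> : u%:S + (a - e%:S) = (u - e)%:S + a by rewrite scalB; ncring.
have [ue|ue] := ltP e u; first by apply: npos_unit => //; lra.
have -> : (u - e)%:S + a = (1 - (e - u)%:S * a^-1) * a.
  by rewrite mulrBl mul1r mulrVK// !scalB; ncring.
rewrite unitrMr//; apply: unit_1B; rewrite cnorm_scalM ger0_norm ?subr_ge0//.
apply: (@le_lt_trans _ _ (e * cnorm a^-1)).
  by apply: ler_wpM2r => //; lra.
by rewrite mulrC ltr_pdivrMr; lra.
Qed.

(** A lower bound r > 0 for e^* e leaves z^* z <= 1 - r, and the C*-identity turns this into a bound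
    on |z|. *)
Lemma cnorm_contractive z e : star z * z + star e * e = 1 -> e \is a GRing.unit ->
  cnorm z < 1.
Proof.
move=> ze eu; have eeu : star e * e \is a GRing.unit by rewrite unitrMl// star_unit.
have [r r0 hr] := npos_unit_scalB _ (npos_star e) eeu.
rewrite -(@expr_lt1 _ 2) ?cnorm_ge0// -cnorm_starM.
have : cnorm (star z * z) <= 1 - r.
  apply: npos_cnorm_le; first exact: npos_star.
  by have <- : star e * e - r%:S = (1 - r)%:S - star z * z by rewrite scalB scal1 -ze; ncring.
lra.
Qed.

End StarProducts.

(** * The half-space and its Cayley transform into the disk *)

Section HalfSpace.
Context {R : realType} {A : cstarAlgType R}.
Implicit Types (h k x y e : A).
Local Notation I := imI.

Lemma imagE h k : imag h = k <-> h - star h = I * (k + k).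
Proof.
have i2 : (2 * 'i : R[i]) != 0 by rewrite mulf_neq0 ?pnatr_eq0// neq0Ci.
have e x : I * (x + x) = (2 * 'i : R[i]) *: x.
  by rewrite mulr_algl -mulr2n -scaler_nat scalerA mulrC.
rewrite e /imag; split=> [<-|->]; first by rewrite scalerA divff// scale1r.
by rewrite scalerA mulVf// scale1r.
Qed.

(** The sum of 1 - i h and its adjoint is 2 + 2 Im h. *)
Lemma unit_1B_imI h : halfspace h -> 1 - I * h \is a GRing.unit.
Proof.
move=> [/positive_npos kp ku]; set k := imag h in kp ku.
have hk : h - star h = I * (k + k) by apply/imagE.
apply: (@accretive_unit _ _ _ (scal 2 + (k + k))).
- by apply: nposD; [apply: npos_scal|apply: nposD].
- by apply: npos_unit => //; apply: nposD.
- rewrite starB starM star_imI star1.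
  transitivity (1 + 1 - I * (h - star h)); first by rewrite mulrBr [I * star h]imIC; ncring.
  rewrite hk mulrA imI_sqr scal_natr; ncring_nat.
Qed.

Lemma disk_Gamma h : halfspace h -> disk (Gamma h).
Proof.
move=> hh; have mu := unit_1B_imI _ hh.
case: hh => [/positive_npos kp ku]; set k := imag h in kp ku.
have hk : h - star h = I * (k + k) by apply/imagE.
have [c [sc cc cu]] := npos_unit_sqrt _ kp ku.
rewrite /disk /= /Gamma !scale_imI; set n := (1 - I * h)^-1.
have nu : n \is a GRing.unit by rewrite unitrV.
(* With c^2 = Im h and n = (1 - i h)^-1, the element e = 2 c n is invertible and completes Gamma^*
   Gamma to 1. *)
apply: (@cnorm_contractive _ _ _ ((c + c) * n)).
  have n1 : (1 - I * h) * n = 1 by rewrite mulrV.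
  have sn1 : star n * (1 + star h * I) = 1.
    have : star ((1 - I * h) * n) = 1 by rewrite n1 star1.
    by rewrite starM starB star1 starM star_imI mulrN opprK.
  rewrite !starM !starD !starM sc star1 star_imI.
  transitivity (star n * ((1 + star h * - I) * (1 + I * h) + (c * c + c * c + (c * c + c * c))) * n).
    ncring.
  have -> : (1 + star h * - I) * (1 + I * h) + (c * c + c * c + (c * c + c * c))
     = (1 + star h * I) * (1 - I * h).
    rewrite cc; have -> : k + k + (k + k) = - (I * (h - star h) + I * (h - star h)).
      by rewrite hk mulrA imI_sqr; ncring.
    by rewrite mulrBr [I * star h]imIC; ncring.
  by rewrite mulrA sn1 mul1r n1.
have -> : c + c = scal 2 * c by rewrite scal_natr mulr_natl mulr2n.
by rewrite -mulrA unit_scalM ?pnatr_eq0// unitrMl.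
Qed.
End HalfSpace.

(** * The action on the half-space *)

Section Moebius.
Context {R : realType} {A : cstarAlgType R}.
Implicit Types (h k x y : A) (g : 'M[A]_2).
Local Notation I := imI.

Lemma mulmx2E m n (M : 'M[A]_(m, 2)) (N : 'M[A]_(2, n)) i j :
  (M *m N) i j = M i 0 * N 0 j + M i 1 * N 1 j.
Proof.
rewrite mxE !big_ord_recl big_ord0 addr0.
by congr (M i _ * N _ j + M i _ * N _ j); apply/val_inj.
Qed.

Lemma matrix2P (M N : 'M[A]_2) : M 0 0 = N 0 0 -> M 0 1 = N 0 1 ->
  M 1 0 = N 1 0 -> M 1 1 = N 1 1 -> M = N.
Proof.
move=> h00 h01 h10 h11; apply/matrixP => i j.
have ord2 (l : 'I_2) : l = 0 \/ l = 1.
  by case: l => [[|[|]]] // p; [left|right]; apply/val_inj.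
by have [->|->] := ord2 i; have [->|->] := ord2 j.
Qed.

Definition col2 x y : 'cV[A]_2 := \col_i (if i == 0 then x else y).

Lemma thetaHE (v w : 'cV[A]_2) :
  thetaH v w = - (I * (star (v 0 0) * w 1 0 - star (v 1 0) * w 0 0)).
Proof. by rewrite /thetaH invCi scaleNr -mulr_algl. Qed.

Lemma thetaH_eq (v w v' w' : 'cV[A]_2) : thetaH v w = thetaH v' w' ->
  star (v 0 0) * w 1 0 - star (v 1 0) * w 0 0 =
  star (v' 0 0) * w' 1 0 - star (v' 1 0) * w' 0 0.
Proof. by rewrite !thetaHE => /oppr_inj/(mulrI imI_unit). Qed.

(** The entries of rhoH g^* rhoH, which is the inverse of [g] when [g] preserves [thetaH]. *)
Definition symplectic_inv g : 'M[A]_2 :=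
  mx22 (star (g 1 1)) (- star (g 0 1)) (- star (g 1 0)) (star (g 0 0)).

(** The form is evaluated on pairs of standard basis vectors. *)
Lemma symplectic_relations g : preserving thetaH g ->
  [/\ star (g 0 0) * g 1 0 = star (g 1 0) * g 0 0,
      star (g 0 1) * g 1 1 = star (g 1 1) * g 0 1 &
      star (g 0 0) * g 1 1 - star (g 1 0) * g 0 1 = 1].
Proof.
move=> [_ hg]; have e x y x' y' :=
  thetaH_eq _ _ _ _ (hg (col2 x y) (col2 x' y')).
split.
- have := e 1 0 1 0; rewrite !mulmx2E !mxE /=.
  by rewrite !(mulr0, mulr1, addr0, star0, star1, subrr) => /subr0_eq.
- have := e 0 1 0 1; rewrite !mulmx2E !mxE /=.
  by rewrite !(mulr0, mulr1, addr0, add0r, star0, star1, subrr, mul0r, oppr0) => /subr0_eq.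
- have := e 1 0 0 1; rewrite !mulmx2E !mxE /=.
  by rewrite !(mulr0, mulr1, addr0, add0r, star0, star1, subrr, mul0r, subr0).
Qed.

Lemma symplectic_invP g : preserving thetaH g -> is_inverse g (symplectic_inv g).
Proof.
move=> hg; have [h1 h2 h3] := symplectic_relations _ hg.
have h4 : star (g 1 1) * g 0 0 - star (g 0 1) * g 1 0 = 1.
  by rewrite -[RHS]star1 -h3 starB !starM !starK.
have inv : symplectic_inv g *m g = 1%:M.
  apply: matrix2P; rewrite mulmx2E !mxE /= ?mulNr.
  - by rewrite h4.
  - by rewrite h2 subrr.
  - by rewrite h1 addrC subrr.
  - by rewrite addrC h3.
(* The relations give a left inverse only; membership in [GL2] makes it two-sided. *)
split => //; case: hg => [[g' [gg' g'g]] _].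
by have -> : symplectic_inv g = g' by rewrite -[LHS]mulmx1 -gg' mulmxA inv mul1mx.
Qed.

Lemma is_inverse_inv2 g g' : is_inverse g g' -> inv2 g = g'.
Proof.
move=> hg; rewrite /inv2; case: xgetP => [y -> [gy yg]|/(_ g') //].
by case: hg => [gg' g'g]; rewrite -[LHS]mulmx1 -gg' mulmxA yg mul1mx.
Qed.

Lemma left_right_unit x y z : y * x = 1 -> x * z = 1 -> x \is a GRing.unit.
Proof.
move=> yx xz; apply/unitrP; exists y; split => //.
by have -> : y = z by rewrite -[LHS]mulr1 -xz mulrA yx mul1r.
Qed.

(** Invariance of [thetaH] at (1, h)^T, with the factor 1 / i removed. *)
Lemma moebius_form g h : preserving thetaH g ->
  star (moebius_den g h) * (g 1 0 + g 1 1 * h) -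
  star (g 1 0 + g 1 1 * h) * moebius_den g h = h - star h.
Proof.
move=> /symplectic_relations[h1 h2 h3].
have h4 : star (g 1 1) * g 0 0 - star (g 0 1) * g 1 0 = 1.
  by rewrite -[RHS]star1 -h3 starB !starM !starK.
rewrite /moebius_den !starD !starM.
transitivity ((star (g 0 0) * g 1 0 - star (g 1 0) * g 0 0)
  + (star (g 0 0) * g 1 1 - star (g 1 0) * g 0 1) * h
  - star h * (star (g 1 1) * g 0 0 - star (g 0 1) * g 1 0)
  + star h * (star (g 0 1) * g 1 1 - star (g 1 1) * g 0 1) * h); first ncring.
by rewrite h1 h2 h3 h4 !subrr; ncring.
Qed.

Lemma moebius_den_unit g h : halfspace h -> preserving thetaH g ->
  moebius_den g h \is a GRing.unit.
Proof.
move=> [/positive_npos kp ku] hg; set k := imag h in kp ku.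
have hk : h - star h = I * (k + k) by apply/imagE.
have form := moebius_form _ h hg; set y1 := moebius_den g h in form *.
set y2 := g 1 0 + _ in form.
have k2 : npos (k + k) by apply: nposD.
have k2u : k + k \is a GRing.unit.
  by rewrite -mulr2n -mulr_natl -scal_natr unit_scalM ?pnatr_eq0.
(* The sum of - i y1^* y2 and its adjoint is 2 Im h, so both are invertible, and the adjoint has y1
   as its last factor. *)
have [z zy] : exists z, z * y1 = 1.
  have mu : star y1 * - (I * y2) \is a GRing.unit.
    apply: (accretive_unit _ _ k2 k2u); rewrite starM starN starM star_imI starK.
    transitivity (- (star y1 * I * y2) + star y2 * I * y1); first ncring.
    rewrite -[star y1 * I]imIC -[star y2 * I]imIC.
    transitivity (- (I * (star y1 * y2 - star y2 * y1))); first ncring.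
    by rewrite form hk mulrA imI_sqr mulN1r opprK.
  have := star_unit _ mu; rewrite starM starK => mu'.
  by exists ((star (- (I * y2)) * y1)^-1 * star (- (I * y2))); rewrite -mulrA mulVr.
(* With h = x + i c^2, y1 c^-1 = q1 + i q2. As q1 q2^* is self-adjoint, cross terms cancel in its
   product with its adjoint, leaving q1 q1^* + q2 q2^*. *)
have [z' yz'] : exists z', y1 * z' = 1.
  have [c [sc cc cu]] := npos_unit_sqrt _ kp ku.
  have [gg' _] := symplectic_invP _ hg.
  have r11 : g 0 0 * star (g 1 1) - g 0 1 * star (g 1 0) = 1.
    by have := congr1 (fun M : 'M_2 => M 0 0) gg'; rewrite mulmx2E !mxE /= mulrN.
  have r12 : g 0 0 * star (g 0 1) = g 0 1 * star (g 0 0).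
    have := congr1 (fun M : 'M_2 => M 0 1) gg'; rewrite mulmx2E !mxE /= mulrN.
    by rewrite addrC => /subr0_eq.
  pose x := scal 2^-1 * (h + star h).
  have sx : star x = x by rewrite starM starD starK star_scal -scalC [star h + h]addrC.
  have hx : h = x + I * (c * c).
    have half (w : A) : scal 2^-1 * (w + w) = w.
      by rewrite -mulr2n -[w *+ 2]mulr_natl -(scal_natr 2) mulrA -scalM mulVf ?pnatr_eq0// scal1 mul1r.
    rewrite cc -[LHS]half /x -[I * k]half -mulrDr -mulrDr -hk; congr (_ * _); ncring.
  pose q1 := (g 0 0 + g 0 1 * x) * c^-1; pose q2 := g 0 1 * c.
  have q12 : q1 * star q2 = q2 * star q1.
    rewrite /q1 /q2 !starM starV// starD starM sc sx mulrA mulrVK//.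
    rewrite [RHS]mulrA [g 0 1 * c * _]mulrK//.
    by rewrite mulrDl [RHS]mulrDr r12 !mulrA.
  have qy : q1 + I * q2 = y1 * c^-1.
    rewrite /q1 /q2 /y1 /moebius_den [in RHS]hx.
    transitivity ((g 0 0 + g 0 1 * x) * c^-1 + I * g 0 1 * c * (c * c^-1)).
      by rewrite mulrV// mulr1 mulrA.
    by rewrite [I * _]imIC; ncring.
  (* By [r11] the first row of [g] is unimodular; the change of columns by x and c preserves this
     and yields the witnesses. *)
  have qu : q1 * star q1 + q2 * star q2 \is a GRing.unit.
    apply: (@unimodular_unit _ _ _ _ (c * star (g 1 1)) (- (c^-1 * (star (g 1 0) + x * star (g 1 1))))).
    rewrite /q1 /q2 mulrA mulrVK// mulrN [g 0 1 * c * _]mulrA mulrK// -[RHS]r11; ncring.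
  clearbody q1 q2.
  have e : (y1 * c^-1) * star (y1 * c^-1) = q1 * star q1 + q2 * star q2.
    rewrite -qy starD starM star_imI.
    transitivity (q1 * star q1 - I * (I * q2 * star q2)); last first.
      by rewrite mulrA mulrA imI_sqr; ncring.
    transitivity (q1 * star q1 - q1 * star q2 * I + I * (q2 * star q1) - I * q2 * (star q2 * I)); first ncring.
    rewrite q12 -[q2 * star q1 * I]imIC -[star q2 * I]imIC.
    rewrite addrNK; congr (_ - _).
    by rewrite mulrA -[I * q2 * I]mulrA -[q2 * I]imIC !mulrA.
  exists (c^-1 * (star (y1 * c^-1) * (q1 * star q1 + q2 * star q2)^-1)).
  by rewrite mulrA [LHS]mulrA e mulrV.
exact: left_right_unit zy yz'.
Qed.

(** The imaginary part of g . h is d^* d with d = c y1^-1 invertible, where c^2 = Im h. *)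
Lemma halfspace_moebius g h : halfspace h -> preserving thetaH g ->
  halfspace (moebius g h).
Proof.
move=> hh hg; have yu := moebius_den_unit _ _ hh hg.
have form := moebius_form _ h hg.
move: hh => [/positive_npos kp ku]; set k := imag h in kp ku.
have hk : h - star h = I * (k + k) by apply/imagE.
have [c [sc cc cu]] := npos_unit_sqrt _ kp ku.
rewrite /moebius; set y1 := moebius_den g h in yu form *.
set y2 := g 1 0 + _ in form *.
have -> : halfspace (y2 * y1^-1) = 
   (positive (star (c * y1^-1) * (c * y1^-1)) /\ star (c * y1^-1) * (c * y1^-1) \is a GRing.unit).
  have im : imag (y2 * y1^-1) = star (c * y1^-1) * (c * y1^-1).
    apply/imagE; rewrite !starM sc.
    have y1V : y1 * y1^-1 = 1 by rewrite mulrV.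
    have sy1V : star y1^-1 * star y1 = 1 by rewrite -starM y1V star1.
    transitivity (star y1^-1 * (h - star h) * y1^-1).
      rewrite -form; transitivity ((star y1^-1 * star y1) * (y2 * y1^-1) -
        star y1^-1 * star y2 * (y1 * y1^-1)); last ncring.
      by rewrite y1V sy1V mul1r mulr1.
    rewrite hk -cc mulrA -imIC; ncring.
  by rewrite /halfspace /= im.
have u : c * y1^-1 \is a GRing.unit by rewrite unitrMl ?unitrV.
by split; [apply/positive_npos; exact: npos_star|rewrite unitrMl// star_unit].
Qed.

End Moebius.

(** * Equivariance of [PhiH], and passage to the disk *)

Section Equivariance.
Context {R : realType} {A : cstarAlgType R}.
Implicit Types (h k x y : A) (g : 'M[A]_2) (v w : 'cV[A]_2).
Local Notation I := imI.

Lemma adjmx2E m n (M : 'M[A]_(m, n)) i j : adjmx M i j = star (M j i).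
Proof. by rewrite !mxE. Qed.

Lemma adjmxM n (g : 'M[A]_2) (v : 'M[A]_(2, n)) :
  adjmx (g *m v) = adjmx v *m adjmx g.
Proof.
by apply/matrixP => i j; rewrite adjmx2E !mulmx2E !adjmx2E starD !starM.
Qed.

Lemma mx22_scal_rhoH : @rhoH R A = mx22 0 (- I) I 0.
Proof. by rewrite /rhoH scaleNr. Qed.

(** For [g] preserving [thetaH] this reads g^* rhoH = rhoH g^-1, which makes [proj_of]
    equivariant. *)
Lemma adjmx_rhoH g : adjmx g *m rhoH = rhoH *m symplectic_inv g.
Proof.
rewrite mx22_scal_rhoH.
apply: matrix2P; rewrite !mulmx2E !adjmx2E !mxE /=;
  rewrite ?(mulr0, mul0r, add0r, addr0, mulNr, mulrN, opprK) ?imIC //.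
Qed.

Lemma proj_of_mulmx g v : preserving thetaH g ->
  proj_of (g *m v) = g *m proj_of v *m symplectic_inv g.
Proof. by move=> hg; rewrite /proj_of adjmxM -!mulmxA adjmx_rhoH. Qed.

(** The fibre from which [PhiH] chooses its vector. *)
Definition KH_over h v := KH v /\ v 1 0 * (v 0 0)^-1 = h.

Lemma KH_mulmx g h v : halfspace h -> preserving thetaH g ->
  KH_over h v -> KH_over (moebius g h) (g *m v).
Proof.
move=> hh hg [[v1 vu] vh]; have yu := moebius_den_unit _ _ hh hg.
have v10 : v 1 0 = h * v 0 0 by rewrite -vh mulrVK.
have e0 : (g *m v) 0 0 = moebius_den g h * v 0 0.
  by rewrite mulmx2E v10 mulrA -mulrDl.
have e1 : (g *m v) 1 0 = (g 1 0 + g 1 1 * h) * v 0 0.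
  by rewrite mulmx2E v10 mulrA -mulrDl.
split; first by split; [rewrite hg.2|rewrite e0 unitrMr].
by rewrite e0 e1 invrM// mulrA mulrK.
Qed.

(** w = v u with u invertible; normalization gives u^* u = 1, so u is unitary and cancels in w
    w^*. *)
Lemma proj_of_KH h v w : KH_over h v -> KH_over h w -> proj_of v = proj_of w.
Proof.
move=> [[v1 vu] vh] [[w1 wu] wh].
pose u := (v 0 0)^-1 * w 0 0.
have uu : u \is a GRing.unit by rewrite unitrMl ?unitrV.
have w00 : w 0 0 = v 0 0 * u by rewrite /u mulVKr.
have w10 : w 1 0 = v 1 0 * u.
  by rewrite -[LHS](mulrVK wu) wh -vh /u mulrA.
clearbody u.
have su : star u * u = 1.
  move: w1; rewrite thetaHE w00 w10 !starM => <-.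
  transitivity (star u * thetaH v v * u); first by rewrite v1 mulr1.
  rewrite thetaHE mulrN mulNr [star u * _]mulrA -imIC; ncring.
have us : u * star u = 1.
  by rewrite -[star u]mulr1 -(mulrV uu) !mulrA -[u * _ * _]mulrA su mulr1 mulrV.
rewrite /proj_of; congr (_ *m _).
apply/matrixP => i j; rewrite !mxE !big_ord1 !mxE.
have wv (l : 'I_2) : w l 0 = v l 0 * u.
  by case: l => [[|[|]]] // p; [move: w00|move: w10];
    congr (w _ 0 = v _ 0 * u); apply/val_inj.
by rewrite !wv starM mulrA -[_ * u * _]mulrA us mulr1.
Qed.

(** (1, h)^T has form value 2 Im h = e^2, so right multiplication by e^-1 normalizes it. *)
Lemma KH_over_exists h : halfspace h -> exists v, KH_over h v.
Proof.
move=> [/positive_npos kp ku]; set k := imag h in kp ku.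
have hk : h - star h = I * (k + k) by apply/imagE.
have k2 : npos (k + k) by apply: nposD.
have k2u : k + k \is a GRing.unit.
  by rewrite -mulr2n -mulr_natl -scal_natr unit_scalM ?pnatr_eq0.
have [e [se ee eu]] := npos_unit_sqrt _ k2 k2u.
have eVu : e^-1 \is a GRing.unit by rewrite unitrV.
exists (col2 e^-1 (h * e^-1)); rewrite /KH_over /KH /= !mxE /=; split; last first.
  by rewrite mulrK.
split => //; rewrite thetaHE !mxE /= !starM starV// se.
have -> : - (I * (e^-1 * (h * e^-1) - e^-1 * star h * e^-1)) =
  - (I * e^-1 * (h - star h) * e^-1) by ncring.
rewrite hk -ee [I * e^-1]imIC.
transitivity (- (e^-1 * (I * I) * e * (e * e^-1))); first ncring.
by rewrite imI_sqr mulrV// mulr1 mulrN1 mulNr opprK mulVr.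
Qed.

Lemma PhiHE h v : KH_over h v -> PhiH h = proj_of v *+ 2 - 1%:M.
Proof.
move=> hv; rewrite /PhiH; congr (_ *+ 2 - _).
apply: (@proj_of_KH h) => //.
by apply: (@xgetPex _ 0 (KH_over h)); exists v.
Qed.

Lemma PhiH_moebius g h : halfspace h -> preserving thetaH g ->
  PhiH (moebius g h) = g *m PhiH h *m inv2 g.
Proof.
move=> hh hg; have [v hv] := KH_over_exists _ hh.
have gi := symplectic_invP _ hg.
rewrite (PhiHE _ _ hv) (PhiHE _ _ (KH_mulmx _ _ _ hh hg hv)) (is_inverse_inv2 _ _ gi).
rewrite proj_of_mulmx// !mulr2n mulmxBr mulmxBl mulmx1 gi.1.
by rewrite mulmxDr mulmxDl.
Qed.

Let s : A := ((sqrtC 2)^-1 : R[i])%:A.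

(** Stated as a sum so that it can be inserted as a factor 1 in ring identities. *)
Lemma sqrt2_inv : s * s + s * s = 1.
Proof.
have sq2 : sqrtC 2 != 0 :> R[i] by rewrite sqrtC_eq0 pnatr_eq0.
rewrite -mulr2n /s mulr_algl scalerA -invfM -expr2 sqrtCK -scaler_nat scalerA.
by rewrite divff ?pnatr_eq0// scale1r.
Qed.

Lemma sqrt2_invC x : s * x = x * s.
Proof. by rewrite /s mulr_algl mulr_algr. Qed.

Lemma star_sqrt2_inv : star s = s.
Proof.
rewrite /s starZ star1 conj_Creal// ger0_real// invr_ge0 sqrtC_ge0 ler0n //.
Qed.

Lemma sqrt2_invMM x y : s * x * (s * y) = s * s * (x * y).
Proof. by rewrite -mulrA [x * _]mulrA -sqrt2_invC !mulrA. Qed.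

Lemma star_sqrt2_invM x : star (s * x) = s * star x.
Proof. by rewrite starM star_sqrt2_inv sqrt2_invC. Qed.

Lemma U_E : [/\ @U R A 0 0 = s * 1, @U R A 0 1 = s * 1,
                @U R A 1 0 = s * I & @U R A 1 1 = s * - I].
Proof. by split; rewrite !mxE /= ?scaleNr. Qed.

Lemma adjU_E : [/\ adjmx (@U R A) 0 0 = s * 1, adjmx (@U R A) 0 1 = s * - I,
                   adjmx (@U R A) 1 0 = s * 1 & adjmx (@U R A) 1 1 = s * I].
Proof.
have [u00 u01 u10 u11] := U_E; rewrite !adjmx2E u00 u01 u10 u11.
by split; rewrite star_sqrt2_invM ?starN ?star_imI ?star1 ?opprK.
Qed.

Lemma unitary_U : is_inverse (adjmx (@U R A)) U.
Proof.
have [u00 u01 u10 u11] := U_E; have [a00 a01 a10 a11] := adjU_E.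
split; apply: matrix2P; rewrite mulmx2E ?u00 ?u01 ?u10 ?u11 ?a00 ?a01 ?a10 ?a11;
  rewrite !sqrt2_invMM -mulrDr !mxE /=;
  rewrite ?(mulrN, mulNr) ?(mulr1, mul1r) ?imI_sqr ?opprK ?addNr ?subrr ?mulr0 //;
  by rewrite mulrDr mulr1 sqrt2_inv.
Qed.

(** In matrix form, U^* rhoH U = rhoD. *)
Lemma thetaH_U v w : thetaH (U *m v) (U *m w) = thetaD v w.
Proof.
have [u00 u01 u10 u11] := U_E.
have e0 (z : 'cV[A]_2) : (U *m z) 0 0 = s * (z 0 0 + z 1 0).
  by rewrite mulmx2E u00 u01; ncring.
have e1 (z : 'cV[A]_2) : (U *m z) 1 0 = s * (I * (z 0 0 - z 1 0)).
  by rewrite mulmx2E u10 u11; ncring.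
rewrite thetaHE !e0 !e1 !star_sqrt2_invM !sqrt2_invMM /thetaD.
have II x y : I * (x * (I * y)) = - (x * y).
  by rewrite mulrA imIC -mulrA [I * (I * y)]mulrA imI_sqr mulN1r mulrN.
rewrite [star (I * _)]starM star_imI.
set p := v 0 0; set q := v 1 0; set p' := w 0 0; set q' := w 1 0.
transitivity (- (I * (s * s * star (p + q) * (I * (p' - q'))))
  - I * (s * s * star (p - q) * (I * (p' + q')))); first ncring.
rewrite !II starD starB -[RHS]mul1r -sqrt2_inv; ncring.
Qed.

Lemma preserving_adjU g : preserving thetaH g -> preserving thetaD (adjmx U *m g *m U).
Proof.
have [aU Ua] := unitary_U; move=> [[g' [gg' g'g]] hg]; split.
  exists (adjmx U *m g' *m U); split.
    rewrite -!mulmxA (mulmxA U (adjmx U)) Ua mul1mx (mulmxA g) gg' mul1mx //.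
  by rewrite -!mulmxA (mulmxA U (adjmx U)) Ua mul1mx (mulmxA g') g'g mul1mx.
move=> v w; rewrite -!thetaH_U !mulmxA Ua !mul1mx -!mulmxA.
by rewrite hg.
Qed.

(** Homogeneous coordinates: products of matrices can be applied factor by factor. *)
Lemma moebiusE g h : moebius g h = (g *m col2 1 h) 1 0 * ((g *m col2 1 h) 0 0)^-1.
Proof. by rewrite /moebius /moebius_den !mulmx2E !mxE /= !mulr1. Qed.

Lemma moebius_adjU g h : halfspace h -> preserving thetaH g ->
  moebius_den (adjmx U *m g *m U) (Gamma h) \is a GRing.unit /\
  Gamma (moebius g h) = moebius (adjmx U *m g *m U) (Gamma h).
Proof.
move=> hh hg; have hh' := halfspace_moebius _ _ hh hg.
have mu := unit_1B_imI _ hh; have mu' := unit_1B_imI _ hh'.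
have yu := moebius_den_unit _ _ hh hg.
have [u00 u01 u10 u11] := U_E; have [a00 a01 a10 a11] := adjU_E.
set n := (1 - I * h)^-1; have nu : n \is a GRing.unit by rewrite unitrV.
have mn : (1 - I * h) * n = 1 by rewrite mulrV.
set y1 := moebius_den g h in yu *; set h' := moebius g h in hh' mu' *.
set y2 := g 1 0 + g 1 1 * h.
have h'y1 : h' * y1 = y2 by rewrite /h' /moebius mulrVK.
have G : Gamma h = (1 + I * h) * n by rewrite /Gamma !scale_imI.
have s2 x y : s * x * (s * (y + y)) = x * y.
  by rewrite sqrt2_invMM mulrDr -[RHS]mul1r -sqrt2_inv; ncring.
(* [G0] and [G1] are the coordinates of U (1, Gamma h)^T before scaling by [s]. *)
have G0 : 1 + Gamma h = n + n by rewrite G -{1}mn; ncring.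
have G1 : I * (1 - Gamma h) = h * n + h * n.
  rewrite G -{1}mn; transitivity (- (I * I) * (h * n + h * n)); first ncring.
  by rewrite imI_sqr opprK mul1r.
have Uv0 : (U *m col2 1 (Gamma h)) 0 0 = s * (n + n).
  by rewrite mulmx2E u00 u01 !mxE /= -G0; ncring.
have Uv1 : (U *m col2 1 (Gamma h)) 1 0 = s * (h * n + h * n).
  by rewrite mulmx2E u10 u11 !mxE /= -G1; ncring.
have gU x y : x * (s * (n + n)) + y * (s * (h * n + h * n)) =
    s * ((x + y * h) * n + (x + y * h) * n).
  transitivity (x * s * (n + n) + y * s * (h * n + h * n)); first ncring.
  by rewrite -!sqrt2_invC; ncring.
(* U^* turns (y1, y2)^T n into multiples of (y1 - i y2) n and (y1 + i y2) n; since y2 = h' y1, the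
   factor y1 n splits off and cancels in the quotient. *)
have w1 : (adjmx U *m g *m U *m col2 1 (Gamma h)) 0 0 = (1 - I * h') * (y1 * n).
  rewrite -!mulmxA mulmx2E a00 a01 !(mulmx2E _ _ g) Uv0 Uv1 !gU !s2.
  by rewrite -[g 0 0 + _]/y1 -[g 1 0 + _]/y2 -h'y1; ncring.
have w2 : (adjmx U *m g *m U *m col2 1 (Gamma h)) 1 0 = (1 + I * h') * (y1 * n).
  rewrite -!mulmxA mulmx2E a10 a11 !(mulmx2E _ _ g) Uv0 Uv1 !gU !s2.
  by rewrite -[g 0 0 + _]/y1 -[g 1 0 + _]/y2 -h'y1; ncring.
have yn : y1 * n \is a GRing.unit by rewrite unitrMl.
have -> : moebius_den (adjmx U *m g *m U) (Gamma h) = (1 - I * h') * (y1 * n).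
  by rewrite -w1 /moebius_den [RHS]mulmx2E !mxE /= mulr1.
split; first by rewrite unitrMl.
rewrite [RHS]moebiusE w1 w2 /Gamma !scale_imI (invrM mu' yn) [RHS]mulrA mulrK //.
Qed.

End Equivariance.

(* Besides the two identities, the conclusion records that every expression in
   them is defined: denominators are units, and each map and each action is
   evaluated inside its domain. *)
Theorem proposition7p6 (R : realType) (A : cstarAlgType R)
    (h : A) (g : 'M[A]_2) :
  halfspace h -> preserving thetaH g ->
  [/\ moebius_den g h \is a GRing.unit,
      halfspace (moebius g h)
    & PhiH (moebius g h) = g *m PhiH h *m inv2 g]
  /\
  let gD := adjmx U *m g *m U in
  [/\ 1 - 'i *: h \is a GRing.unit,
      disk (Gamma h),
      preserving thetaD gD,
      moebius_den gD (Gamma h) \is a GRing.unit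
    & Gamma (moebius g h) = moebius gD (Gamma h)].
Proof.
move=> hh hg; have [hden heq] := moebius_adjU _ _ hh hg.
split; split => //.
- exact: moebius_den_unit.
- exact: halfspace_moebius.
- exact: PhiH_moebius.
- by rewrite scale_imI; exact: unit_1B_imI.
- exact: disk_Gamma.
- exact: preserving_adjU.
Qed.
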